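(* Every $\mathrm{CAT}(-1)$ space is strongly hyperbolic.
   Context: Notation: $|x,y|$ is the distance between points $x,y$ of a metric space $X$, and $(x,y)_o=\tfrac12\big(|x,o|+|y,o|-|x,y|\big)$ is the Gromov product with respect to $o\in X$. A metric space $X$ is strongly hyperbolic with parameter $\epsilon>0$ if $\exp(-\epsilon (x,y)_o)\le \exp(-\epsilon (x,z)_o)+\exp(-\epsilon (z,y)_o)$ for all $x,y,z,o\in X$. It is strongly hyperbolic if this holds for some parameter $\epsilon>0$. A geodesic metric space $X$ is $\mathrm{CAT}(-1)$ if and only if it satisfies the following four-point characterization: for all $x_1,x_2,x_3,x_4\in X$ there are points $\tilde x_1,\tilde x_2,\tilde x_3,\tilde x_4$ in the hyperbolic plane $\mathbb{H}^2$ (of constant curvature $-1$) such that $|x_1,x_2|=|\tilde x_1,\tilde x_2|$, $|x_2,x_3|=|\tilde x_2,\tilde x_3|$, $|x_3,x_4|=|\tilde x_3,\tilde x_4|$, $|x_4,x_1|=|\tilde x_4,\tilde x_1|$, while $|x_1,x_3|\le|\tilde x_1,\tilde x_3|$ and $|x_2,x_4|\le|\tilde x_2,\tilde x_4|$. *)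

(* Defs.v *)
(* Over Stdlib's classical real numbers and its Metric_Space structure. *)
From Stdlib Require Import Reals.
Open Scope R_scope.

Definition gromov_product (X : Metric_Space) (o x y : Base X) : R :=
  / 2 * (dist X x o + dist X y o - dist X x y).

Definition strongly_hyperbolic_with (X : Metric_Space) (eps : R) : Prop :=
  forall x y z o : Base X,
    exp (- eps * gromov_product X o x y) <=
    exp (- eps * gromov_product X o x z) + exp (- eps * gromov_product X o z y).

Definition strongly_hyperbolic (X : Metric_Space) : Prop :=
  exists eps : R, 0 < eps /\ strongly_hyperbolic_with X eps.

(* Only the values of [gamma] on [0, dist X x y] matter. *)
Definition geodesic_space (X : Metric_Space) : Prop :=
  forall x y : Base X, exists gamma : R -> Base X,
    gamma 0 = x /\ gamma (dist X x y) = y /\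
    forall s t : R, 0 <= s <= dist X x y -> 0 <= t <= dist X x y ->
      dist X (gamma s) (gamma t) = Rabs (s - t).

(* The hyperbolic plane of constant curvature -1, in the upper half-plane
   model with line element (dx^2 + dy^2) / y^2. *)
Record H2 : Type := mkH2 { H2_x : R; H2_y : R; H2_y_pos : 0 < H2_y }.

(* The distance d of that line element satisfies
   sinh (d / 2) = |p - q| / (2 sqrt (y_p y_q)), with |p - q| Euclidean;
   equivalently cosh d = 1 + |p - q|^2 / (2 y_p y_q). *)
Definition H2_dist (p q : H2) : R :=
  2 * arcsinh (dist_euc (H2_x p) (H2_y p) (H2_x q) (H2_y q)
               / (2 * sqrt (H2_y p * H2_y q))).

(* CAT(-1) for geodesic spaces, by subembedding of four-point configurations
   into the hyperbolic plane: the four sides are preserved and the two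
   diagonals do not decrease. *)
Definition CAT_minus_1 (X : Metric_Space) : Prop :=
  geodesic_space X /\
  forall x1 x2 x3 x4 : Base X, exists y1 y2 y3 y4 : H2,
    dist X x1 x2 = H2_dist y1 y2 /\
    dist X x2 x3 = H2_dist y2 y3 /\
    dist X x3 x4 = H2_dist y3 y4 /\
    dist X x4 x1 = H2_dist y4 y1 /\
    dist X x1 x3 <= H2_dist y1 y3 /\
    dist X x2 x4 <= H2_dist y2 y4.

(* Main.v *)
Require Import Defs.
From Stdlib Require Import Reals Lra.
From Coquelicot Require Import Complex.
Open Scope R_scope.

(** The parameter is [eps = 1].  Multiplying the defining inequality by
    [exp ((|x,o| + |y,o| + |z,o|) / 2)] turns it into an inequality of
    Ptolemy type for the function [exp (d / 2)]:

      e^{|x,y|/2} e^{|z,o|/2}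
        <= e^{|x,z|/2} e^{|y,o|/2} + e^{|z,y|/2} e^{|o,x|/2}.

    The left-hand side involves the two diagonals of the quadrilateral
    x, z, y, o and the right-hand side its four sides, so the four-point
    condition reduces the claim to the hyperbolic plane
    ([H2_ptolemy_exp_half_dist]).

    There, regard points of the upper half-plane as complex numbers.  Then
    [sinh (d/2)] and [cosh (d/2)] are [|p - q|] and [|p - conj q|] divided by
    [2 sqrt (Im p * Im q)], so [exp (d/2)] is, up to that factor, the sum
    [|p - q| + |p - conj q|].  The factors contribute the same product to each
    of the three terms and cancel.  What remains is
    [ptolemy_with_conjugates], which comes from adding suitable instances of
    the Euclidean Ptolemy inequality in which some of the four points are
    replaced by their mirror images in the real axis. *)

Lemma Cmod_sub_sym (a b : C) : Cmod (a - b) = Cmod (b - a).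
Proof.
rewrite <- Cmod_opp; f_equal; ring.
Qed.

Lemma Cmod_sub_conj_sym (a b : C) : Cmod (a - Cconj b) = Cmod (b - Cconj a).
Proof.
destruct a as [a1 a2], b as [b1 b2].
unfold Cmod; simpl; f_equal; ring.
Qed.

Lemma Cmod_sub_conj_conj (a b : C) : Cmod (Cconj a - Cconj b) = Cmod (a - b).
Proof.
destruct a as [a1 a2], b as [b1 b2].
unfold Cmod; simpl; f_equal; ring.
Qed.

(** The triangle inequality applied to the identity
    (a - c)(b - d) = (a - b)(c - d) + (b - c)(a - d). *)
Lemma ptolemy (a b c d : C) :
  Cmod (a - c) * Cmod (b - d) <=
  Cmod (a - b) * Cmod (c - d) + Cmod (b - c) * Cmod (a - d).
Proof.
rewrite <- !Cmod_mult.
replace ((a - c) * (b - d))%C with ((a - b) * (c - d) + (b - c) * (a - d))%C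
  by ring.
apply Cmod_triangle.
Qed.

(** Two points of the closed upper half-plane lie on the same side of the
    mirror, so reflecting one of them moves it away from the other. *)
Lemma Cmod_sub_le_sub_conj (a b : C) :
  0 <= Im a -> 0 <= Im b -> Cmod (a - b) <= Cmod (a - Cconj b).
Proof.
destruct a as [a1 a2], b as [b1 b2]; simpl; intros Ha Hb.
unfold Cmod; simpl; apply sqrt_le_1_alt; nra.
Qed.

(** Write [A] for the distances [|p - q|] and [B] for [|p - conj q|].  After
    expanding, the [A A] terms are related by the plain Ptolemy inequality.
    For the [B B] terms, reflecting a pair of adjacent vertices gives the bound
    with one product [B B] replaced by [A A], which is stronger as [A <= B].
    Each mixed term [A B] is bounded in two ways, by reflecting either endpoint
    of the diagonal measured by [B]; the average of the two bounds, summed over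
    both mixed terms, is exactly the mixed part of the right-hand side. *)
Lemma ptolemy_with_conjugates (a b c d : C) :
  0 <= Im a -> 0 <= Im b -> 0 <= Im c -> 0 <= Im d ->
  (Cmod (a - c) + Cmod (a - Cconj c)) * (Cmod (b - d) + Cmod (b - Cconj d)) <=
  (Cmod (a - b) + Cmod (a - Cconj b)) * (Cmod (c - d) + Cmod (c - Cconj d)) +
  (Cmod (b - c) + Cmod (b - Cconj c)) * (Cmod (a - d) + Cmod (a - Cconj d)).
Proof.
intros Ha Hb Hc Hd.
pose proof (ptolemy a b c d) as HAA.
pose proof (ptolemy a b (Cconj c) (Cconj d)) as HBB.
pose proof (ptolemy (Cconj a) b c d) as Ha'.
pose proof (ptolemy a (Cconj b) c d) as Hb'.
pose proof (ptolemy a b (Cconj c) d) as Hc'.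
pose proof (ptolemy a b c (Cconj d)) as Hd'.
rewrite Cmod_sub_conj_conj in HBB.
rewrite (Cmod_sub_sym (Cconj a) c), (Cmod_sub_sym (Cconj a) b),
  (Cmod_sub_sym (Cconj a) d), (Cmod_sub_conj_sym c a),
  (Cmod_sub_conj_sym b a), (Cmod_sub_conj_sym d a) in Ha'.
rewrite (Cmod_sub_sym (Cconj b) d), (Cmod_sub_sym (Cconj b) c),
  (Cmod_sub_conj_sym d b), (Cmod_sub_conj_sym c b) in Hb'.
rewrite (Cmod_sub_sym (Cconj c) d), (Cmod_sub_conj_sym d c) in Hc'.
assert (HAB : Cmod (a - b) * Cmod (c - d) <=
              Cmod (a - Cconj b) * Cmod (c - Cconj d)).
{ apply Rmult_le_compat; auto using Cmod_ge_0, Cmod_sub_le_sub_conj. }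
lra.
Qed.

Definition H2_to_C (p : H2) : C := (H2_x p, H2_y p).

Lemma exp_arcsinh (t : R) : exp (arcsinh t) = t + sqrt (t ^ 2 + 1).
Proof.
unfold arcsinh; apply exp_ln.
(* [sqrt (t^2 + 1)] exceeds [|t|] because its square exceeds [t^2]. *)
pose proof (sqrt_sqrt (t ^ 2 + 1) ltac:(nra)) as Hs.
pose proof (sqrt_pos (t ^ 2 + 1)) as Hp.
nra.
Qed.

(** In the identity [|p - conj q|^2 = |p - q|^2 + 4 Im p Im q] one recognises
    [cosh^2 = sinh^2 + 1] for [d / 2]. *)
Lemma exp_half_H2_dist (p q : H2) :
  exp (H2_dist p q / 2) * (2 * (sqrt (H2_y p) * sqrt (H2_y q))) =
  Cmod (H2_to_C p - H2_to_C q) + Cmod (H2_to_C p - Cconj (H2_to_C q)).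
Proof.
destruct p as [px py Hp], q as [qx qy Hq].
unfold H2_dist, H2_to_C; simpl.
rewrite <- sqrt_mult by lra.
set (s := sqrt (py * qy)).
assert (Hpq : 0 < py * qy) by (apply Rmult_lt_0_compat; assumption).
assert (Hs : 0 < s) by (apply sqrt_lt_R0; assumption).
assert (Hs2 : s * s = py * qy) by (apply sqrt_sqrt; lra).
set (A := dist_euc px py qx qy).
assert (HA : Cmod ((px, py) - (qx, qy)) = A).
{ unfold Cmod, A, dist_euc; simpl; f_equal; unfold Rsqr; ring. }
assert (HA2 : A * A = (px - qx) ^ 2 + (py - qy) ^ 2).
{ unfold A, dist_euc; rewrite sqrt_sqrt.
  - unfold Rsqr; ring.
  - apply Rplus_le_le_0_compat; apply Rle_0_sqr. }
assert (HB : Cmod ((px, py) - Cconj (qx, qy)) =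
             2 * s * sqrt ((A / (2 * s)) ^ 2 + 1)).
{ rewrite <- (sqrt_square (2 * s)) at 1 by lra.
  rewrite <- sqrt_mult_alt by nra.
  unfold Cmod; f_equal.
  replace (2 * s * (2 * s) * ((A / (2 * s)) ^ 2 + 1))
    with (A * A + 4 * (s * s)) by (field; lra).
  rewrite HA2, Hs2; simpl; ring. }
rewrite HA, HB.
replace (2 * arcsinh (A / (2 * s)) / 2) with (arcsinh (A / (2 * s))) by field.
rewrite exp_arcsinh; field; lra.
Qed.

Lemma H2_ptolemy_exp_half_dist (p1 p2 p3 p4 : H2) :
  exp (H2_dist p1 p3 / 2) * exp (H2_dist p2 p4 / 2) <=
  exp (H2_dist p1 p2 / 2) * exp (H2_dist p3 p4 / 2) +
  exp (H2_dist p2 p3 / 2) * exp (H2_dist p1 p4 / 2).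
Proof.
pose proof (ptolemy_with_conjugates
  (H2_to_C p1) (H2_to_C p2) (H2_to_C p3) (H2_to_C p4)
  (Rlt_le _ _ (H2_y_pos p1)) (Rlt_le _ _ (H2_y_pos p2))
  (Rlt_le _ _ (H2_y_pos p3)) (Rlt_le _ _ (H2_y_pos p4))) as H.
rewrite <- !exp_half_H2_dist in H.
pose proof (sqrt_lt_R0 _ (H2_y_pos p1)) as H1.
pose proof (sqrt_lt_R0 _ (H2_y_pos p2)) as H2'.
pose proof (sqrt_lt_R0 _ (H2_y_pos p3)) as H3.
pose proof (sqrt_lt_R0 _ (H2_y_pos p4)) as H4.
apply Rmult_le_reg_r with
  (4 * (sqrt (H2_y p1) * sqrt (H2_y p2) * (sqrt (H2_y p3) * sqrt (H2_y p4)))).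
{ repeat apply Rmult_lt_0_compat; lra. }
lra.
Qed.

Lemma H2_dist_sym (p q : H2) : H2_dist p q = H2_dist q p.
Proof.
unfold H2_dist; rewrite distance_symm, (Rmult_comm (H2_y p)); reflexivity.
Qed.

Lemma exp_le_exp (s t : R) : s <= t -> exp s <= exp t.
Proof.
intros [Hlt | Heq]; [left; apply exp_increasing; exact Hlt | right; congruence].
Qed.

(** Only the diagonals occur on the left-hand side, so it does not decrease
    when the quadrilateral is replaced by its comparison quadrilateral. *)
Lemma CAT_minus_1_ptolemy_exp_half_dist (X : Metric_Space)
    (x1 x2 x3 x4 : Base X) :
  CAT_minus_1 X ->
  exp (dist X x1 x3 / 2) * exp (dist X x2 x4 / 2) <=
  exp (dist X x1 x2 / 2) * exp (dist X x3 x4 / 2) +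
  exp (dist X x2 x3 / 2) * exp (dist X x4 x1 / 2).
Proof.
intros [_ Hsub].
destruct (Hsub x1 x2 x3 x4)
  as (p1 & p2 & p3 & p4 & E12 & E23 & E34 & E41 & L13 & L24).
rewrite E12, E23, E34, E41, (H2_dist_sym p4 p1).
eapply Rle_trans; [| apply H2_ptolemy_exp_half_dist].
apply Rmult_le_compat; try (left; apply exp_pos); apply exp_le_exp; lra.
Qed.

Theorem theorem1p2 :
  forall X : Metric_Space, CAT_minus_1 X -> strongly_hyperbolic X.
Proof.
intros X HX; exists 1; split; [lra |]; intros x y z o.
pose proof (CAT_minus_1_ptolemy_exp_half_dist X x z y o HX) as H.
apply Rmult_le_reg_r with
  (exp ((dist X x o + dist X y o + dist X z o) / 2)); [apply exp_pos |].
rewrite Rmult_plus_distr_r, <- !exp_plus; rewrite <- !exp_plus in H.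
unfold gromov_product; rewrite (dist_sym X o x) in H.
replace (- (1) * (/ 2 * (dist X x o + dist X y o - dist X x y)) +
         (dist X x o + dist X y o + dist X z o) / 2)
  with (dist X x y / 2 + dist X z o / 2) by field.
replace (- (1) * (/ 2 * (dist X x o + dist X z o - dist X x z)) +
         (dist X x o + dist X y o + dist X z o) / 2)
  with (dist X x z / 2 + dist X y o / 2) by field.
replace (- (1) * (/ 2 * (dist X z o + dist X y o - dist X z y)) +
         (dist X x o + dist X y o + dist X z o) / 2)
  with (dist X z y / 2 + dist X x o / 2) by field.
exact H.
Qed.
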